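(* For every $n\geq 0$, the map $\psi$ restricts to a bijection from $\mathcal{B}_n$ onto the set $\mathcal{M}_n$ of Motzkin paths of length $n$, where $\mathcal{B}_n$ is the set of Łukasiewicz paths of length $n$ having no flat step $F$ at positive height.
   Context: A Łukasiewicz path of length $n$ is a sequence of $n$ steps from $\{(1,i): i\geq -1\}$ starting at $(0,0)$, ending at $(n,0)$ and never going below the $x$-axis; a Motzkin path is one whose steps lie in $\{U,F,D\}$. Write $D=(1,-1)$, $F=(1,0)$, $U=U_1=(1,1)$, $U_k=(1,k)$; $\epsilon$ is the empty path. The height of a step is the minimal ordinate of its endpoints. Every nonempty Łukasiewicz path is uniquely either $FL$ or $U_kL_1DL_2D\cdots L_kDL$ with $k\geq1$ and $L,L_1,\dots,L_k$ Łukasiewicz paths (translated vertically). The map $\psi$ from Łukasiewicz paths to Motzkin paths is defined recursively by $\psi(\epsilon)=\epsilon$, $\psi(FL)=F\psi(L)$, and $\psi(U_kL_1DL_2D\cdots L_kDL)=U\psi(L_1)F\psi(L_2)F\cdots F\psi(L_k)D\psi(L)$ (i.e. $U$, then $\psi(L_1),\dots,\psi(L_k)$ separated by $F$ steps, then $D$, then $\psi(L)$). *)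

(* Defs.v *)
From HB Require Import structures.
From mathcomp Require Import all_boot all_order all_algebra zify.
From mathcomp Require Import classical_sets functions.

Set Implicit Arguments.
Unset Strict Implicit.
Unset Printing Implicit Defensive.

Import Order.TTheory GRing.Theory Num.Theory.
Local Open Scope ring_scope.

(* The step (1, i) is represented by i, and a path by the sequence of its
   steps; its abscissas, hence its length, are given by the size. *)
Definition D : int := -1.
Definition F : int := 0.
Definition U (k : nat) : int := k%:Z.

Definition ordinate (s : seq int) (i : nat) : int := \sum_(x <- take i s) x.

Definition lukasiewicz (s : seq int) : Prop :=
  [/\ forall x, x \in s -> -1 <= x,
      forall i, (i <= size s)%N -> 0 <= ordinate s i
    & ordinate s (size s) = 0].

Definition motzkin (s : seq int) : Prop :=
  lukasiewicz s /\ forall x, x \in s -> x \in [:: U 1; F; D].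

Definition step_height (s : seq int) (i : nat) : int :=
  Num.min (ordinate s i) (ordinate s i.+1).

Definition no_positive_flat (s : seq int) : Prop :=
  forall i, (i < size s)%N -> nth 0 s i = F -> ~ 0 < step_height s i.

Definition B (n : nat) : set (seq int) :=
  [set s | [/\ lukasiewicz s, size s = n & no_positive_flat s]]%classic.

Definition M (n : nat) : set (seq int) :=
  [set s | motzkin s /\ size s = n]%classic.

(* If h = 0 and s = L D R with L a Lukasiewicz path, this is (L, R): the cut is
   at the first step that goes below the x-axis when s starts at ordinate h. *)
Fixpoint first_below (h : int) (s : seq int) : seq int * seq int :=
  if s is x :: s' then
    if h + x < 0 then ([::], s')
    else let p := first_below (h + x) s' in (x :: p.1, p.2)
  else ([::], [::]).

(* Maps L_1 D L_2 D ... L_k D L to ([:: L_1; ...; L_k], L). *)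
Fixpoint split_down (k : nat) (s : seq int) : seq (seq int) * seq int :=
  if k is k'.+1 then
    let p := first_below 0 s in
    let q := split_down k' p.2 in (p.1 :: q.1, q.2)
  else ([::], s).

Definition join_flat (Ls : seq (seq int)) : seq int :=
  if Ls is L :: Ls' then L ++ flatten [seq F :: L' | L' <- Ls'] else [::].

(* The recursion is on a bound n on the size of the path. *)
Fixpoint psi_rec (n : nat) (s : seq int) : seq int :=
  match n, s with
  | n'.+1, x :: s' =>
      if x == F then F :: psi_rec n' s'
      else let q := split_down `|x|%N s' in
           U 1 :: join_flat [seq psi_rec n' L | L <- q.1] ++ D :: psi_rec n' q.2
  | _, _ => [::]
  end.

(* Only meaningful on Lukasiewicz paths. The recursive definition of psi is
   given by the lemmas psi_nil, psi_F and psi_U below. *)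
Definition psi (s : seq int) : seq int := psi_rec (size s) s.

Lemma size_first_below h s :
  (size (first_below h s).1 <= size s)%N /\ (size (first_below h s).2 <= size s)%N.
Proof.
elim: s h => [|x s IH] h //=; case: ifP => _ //=.
have [h1 h2] := IH (h + x); by split => //; exact: leqW.
Qed.

Lemma size_split_down k s :
  (forall L, L \in (split_down k s).1 -> (size L <= size s)%N) /\
  (size (split_down k s).2 <= size s)%N.
Proof.
elim: k s => [|k IH] s //=.
have [h1 h2] := size_first_below 0 s; have [i1 i2] := IH (first_below 0 s).2.
split; last exact: leq_trans i2 h2.
move=> L; rewrite inE => /orP [/eqP -> //|/i1 hL].
exact: leq_trans hL h2.
Qed.

Lemma psi_rec_enough n s : (size s <= n)%N -> psi_rec n s = psi s.
Proof.
rewrite /psi.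
suff H : forall n m s, (size s <= n)%N -> (size s <= m)%N ->
    psi_rec n s = psi_rec m s by move=> h; exact: H.
elim=> [|{}n IH] [|m] [|x {}s] //= h1 h2.
case: ifP => _; first by rewrite (IH m).
have [i1 i2] := size_split_down `|x|%N s.
have le1 k : (k <= size s)%N -> (k <= n)%N by move/leq_trans; exact.
have le2 k : (k <= size s)%N -> (k <= m)%N by move/leq_trans; exact.
rewrite (IH m (split_down _ _).2); [|exact: le1|exact: le2].
congr (_ :: join_flat _ ++ _); apply/eq_in_map => L /i1 hL.
by apply: IH; [exact: le1|exact: le2].
Qed.

Lemma first_below_cat h L R :
  (forall i, (i <= size L)%N -> 0 <= h + ordinate L i) ->
  h + ordinate L (size L) = 0 -> first_below h (L ++ D :: R) = (L, R).
Proof.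
elim: L h => [|x L IH] h h1 h2 /=.
  move: h2; rewrite /ordinate /= big_nil addr0 => ->.
  by rewrite add0r.
have ordS i : h + ordinate (x :: L) i.+1 = h + x + ordinate L i.
  by rewrite /ordinate /= big_cons addrA.
have := h1 1%N isT; rewrite ordS /ordinate take0 big_nil addr0 => hx.
rewrite ltNge hx /= IH //; last by rewrite -ordS.
by move=> i hi; rewrite -ordS; exact: h1.
Qed.

Lemma split_down_cat (Ls : seq (seq int)) (L : seq int) :
  (forall L', L' \in Ls -> lukasiewicz L') ->
  split_down (size Ls) (flatten [seq rcons L' D | L' <- Ls] ++ L) = (Ls, L).
Proof.
elim: Ls => [|L1 Ls IH] //= hL.
have [_ h2 h3] := hL L1 (mem_head _ _).
rewrite -catA cat_rcons first_below_cat ?add0r //=; last first.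
  by move=> i hi; rewrite add0r; exact: h2.
by rewrite IH // => L' hL'; apply: hL; rewrite inE hL' orbT.
Qed.

Lemma psi_nil : psi [::] = [::].
Proof. by []. Qed.

Lemma psi_F (L : seq int) : psi (F :: L) = F :: psi L.
Proof. by []. Qed.

Lemma psi_U (k : nat) (Ls : seq (seq int)) (L : seq int) :
  (1 <= k)%N -> size Ls = k -> (forall L', L' \in Ls -> lukasiewicz L') ->
  psi (U k :: flatten [seq rcons L' D | L' <- Ls] ++ L) =
  U 1 :: join_flat [seq psi L' | L' <- Ls] ++ D :: psi L.
Proof.
move=> k_gt0 sz hL; rewrite -{}sz in k_gt0 *.
have := size_split_down (size Ls) (flatten [seq rcons L' D | L' <- Ls] ++ L).
have := split_down_cat L hL; set s := _ ++ L => eq_split [i1 i2].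
have : U (size Ls) != F by rewrite /U /F; lia.
rewrite {1}/psi /= => /negPf ->.
rewrite eq_split /= in i1 i2 *; rewrite (psi_rec_enough i2).
congr (_ :: join_flat _ ++ _).
by apply/eq_in_map => L' /i1; exact: psi_rec_enough.
Qed.

(* Main.v *)
From mathcomp Require Import all_boot all_order all_algebra zify.
From mathcomp Require Import classical_sets.
Require Import Defs.
From mathcomp Require Import functions.

Set Implicit Arguments.
Unset Strict Implicit.
Unset Printing Implicit Defensive.

Import Order.TTheory GRing.Theory Num.Theory.
Local Open Scope ring_scope.

(** Read from left to right, [psi] is a pushdown transducer: [U_k] is sent to
    [U] and pushes a counter for its [k] matching down steps, and each down step
    decrements the top counter, being sent to [D] if it exhausts it and to [F]
    otherwise. The ordinate of the input is the sum of the counters, that of the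
    output is their number. When flat steps only occur on the empty stack, the
    input can be recovered by reading the output from right to left: [D] opens a
    counter, [F] increments the top counter (or is a flat step if there is
    none), and [U] closes the top counter [k] and comes from [U_k]. *)

(** Structural recursion with an arbitrary starting ordinate [h], so that suffixes of a path can be
    handled by induction. [P] sees the ordinate before each step, which lets it forbid flat steps by
    height. *)
Fixpoint path_from (P : int -> int -> bool) (h : int) (s : seq int) : bool :=
  if s is x :: s' then [&& P h x, 0 <= h + x & path_from P (h + x) s']
  else h == 0.

Definition lukasiewicz_step (h x : int) : bool := -1 <= x.

Definition B_step (h x : int) : bool := (-1 <= x) && ((x == F) ==> (h <= 0)).

Definition motzkin_step (h x : int) : bool := x \in [:: U 1; F; D].

Lemma ordinate0 s : ordinate s 0 = 0.
Proof. by rewrite /ordinate take0 big_nil. Qed.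

Lemma ordinate_cons x s i : ordinate (x :: s) i.+1 = x + ordinate s i.
Proof. by rewrite /ordinate /= big_cons. Qed.

Lemma path_fromP (P : int -> int -> bool) h s : 0 <= h ->
  reflect [/\ forall i, (i < size s)%N -> P (h + ordinate s i) (nth 0 s i),
              forall i, (i <= size s)%N -> 0 <= h + ordinate s i
            & h + ordinate s (size s) = 0]
          (path_from P h s).
Proof.
elim: s h => [|x s IH] h h_ge0 /=.
  rewrite ordinate0 addr0; apply: (iffP eqP) => [h0|[]//]; split=> // i.
  by rewrite leqn0 => /eqP ->; rewrite ordinate0 addr0.
apply: (iffP and3P) => [[Px hx /(IH _ hx) [Ps s_ge0 s_end]]|[Ps s_ge0 s_end]].
  split; last by rewrite ordinate_cons addrA.
  - by case=> [|i] hi; rewrite ?ordinate0 ?addr0 // ordinate_cons addrA; exact: Ps.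
  - by case=> [|i] hi; rewrite ?ordinate0 ?addr0 // ordinate_cons addrA; exact: s_ge0.
have hx : 0 <= h + x.
  by have := s_ge0 1%N isT; rewrite ordinate_cons ordinate0 addr0.
split=> //; first by have := Ps 0%N isT; rewrite ordinate0 addr0.
apply/(IH _ hx); split; last by rewrite -addrA -ordinate_cons.
- by move=> i hi; rewrite -addrA -ordinate_cons; exact: (Ps i.+1).
- by move=> i hi; rewrite -addrA -ordinate_cons; exact: s_ge0.
Qed.

Lemma lukasiewiczE s : lukasiewicz s <-> path_from lukasiewicz_step 0 s.
Proof.
split=> [[s_ge s_ge0 s_end]|/(path_fromP _ _ (lexx 0)) [s_ge s_ge0 s_end]].
  apply/path_fromP => //; split; rewrite ?add0r // => i hi; last first.
    by rewrite add0r; exact: s_ge0.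
  by apply: s_ge; rewrite mem_nth.
split=> [x /(nthP 0) [i hi <-]|i hi|]; first exact: s_ge.
  by have := s_ge0 i hi; rewrite add0r.
by rewrite -[LHS]add0r.
Qed.

Lemma step_height_flat s i : (i < size s)%N -> nth 0 s i = F ->
  step_height s i = ordinate s i.
Proof.
move=> hi si; rewrite /step_height /ordinate (take_nth 0 hi) -cats1 big_cat /=.
by rewrite big_seq1 si addr0 minxx.
Qed.

Lemma BE n s : B n s <-> path_from B_step 0 s /\ size s = n.
Proof.
split=> [[[s_ge s_ge0 s_end] <- s_flat]|[/(path_fromP _ _ (lexx 0)) [Ps s_ge0 s_end] <-]].
  split=> //; apply/path_fromP => //; split; rewrite ?add0r // => i hi; last first.
    by rewrite add0r; exact: s_ge0.
  apply/andP; split; first by apply: s_ge; rewrite mem_nth.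
  apply/implyP => /eqP si; rewrite add0r leNgt -(step_height_flat hi si).
  by apply/negP/s_flat.
split=> //.
  split=> [x /(nthP 0) [i hi <-]|i hi|]; first by case/andP: (Ps i hi).
    by have := s_ge0 i hi; rewrite add0r.
  by rewrite -[LHS]add0r.
move=> i hi si; rewrite step_height_flat //; apply/negP; rewrite -leNgt.
by case/andP: (Ps i hi); rewrite si eqxx add0r.
Qed.

Lemma ME n s : M n s <-> path_from motzkin_step 0 s /\ size s = n.
Proof.
split=> [[[[s_ge s_ge0 s_end] s_in] <-]|[/(path_fromP _ _ (lexx 0)) [Ps s_ge0 s_end] <-]].
  split=> //; apply/path_fromP => //; split; rewrite ?add0r // => i hi; last first.
    by rewrite add0r; exact: s_ge0.
  by apply: s_in; rewrite mem_nth.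
have s_in x : x \in s -> x \in [:: U 1; F; D].
  by move=> /(nthP 0) [i hi <-]; exact: Ps.
split=> //; split=> //; split=> [x /s_in|i hi|].
- by rewrite !inE => /or3P [] /eqP ->.
- by have := s_ge0 i hi; rewrite add0r.
- by rewrite -[LHS]add0r.
Qed.

(* A counter [c] on the stack stands for [c.+1] pending down steps. *)
Fixpoint transduce (st : seq nat) (s : seq int) : seq int :=
  if s is x :: s' then
    if x == F then F :: transduce st s'
    else if 0 < x then U 1 :: transduce (`|x|%N.-1 :: st) s'
    else match st with
         | c.+1 :: st' => F :: transduce (c :: st') s'
         | 0%N :: st' => D :: transduce st' s'
         | [::] => [::]
         end
  else [::].

(** The last branch also catches an up step on the empty stack, a default that no suffix of a
    Motzkin path reaches. *)
Fixpoint untransduce (m : seq int) : seq nat * seq int :=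
  if m is x :: m' then
    let: (st, s) := untransduce m' in
    if x == D then (0%N :: st, D :: s)
    else match st with
         | c :: st' => if x == F then (c.+1 :: st', D :: s)
                       else (st', U c.+1 :: s)
         | [::] => ([::], F :: s)
         end
  else ([::], [::]).

Definition pending (st : seq nat) : nat := sumn [seq c.+1 | c <- st].

Variant step_spec (x : int) : Prop :=
  | IsFlat of x = F
  | IsUp c of x = U c.+1
  | IsDown of x = D.

Lemma stepP x : -1 <= x -> step_spec x.
Proof.
case: x => [[|c]|[|c]] // _; [exact: IsFlat|exact: IsUp|exact: IsDown].
Qed.

(** The invariant of the transducer, for any stack: the remaining input starts at ordinate
    [pending st] and the remaining output at ordinate [size st]. Reading backwards restores the
    stack as well as the input. *)
Lemma transduceK st s :
  path_from B_step (pending st)%:Z s ->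
  [/\ path_from motzkin_step (size st)%:Z (transduce st s),
      size (transduce st s) = size s
    & untransduce (transduce st s) = (st, s)].
Proof.
elim: s st => [|x s IH] st /=; first by case: st.
case/and3P => /andP [/stepP x_ge x_flat] hx hs.
case: x_ge => [xE|c xE|xE]; rewrite {}xE /= in x_flat hx hs *.
(* A flat step is allowed only at ordinate 0, where no counter is pending; hence [untransduce]
   cannot mistake this [F] for an increment. *)
- have {hx x_flat} st0 : st = [::] by case: st x_flat {hx hs} => //= c st; lia.
  by rewrite st0 in hs *; have [/= -> -> ->] := IH [::] hs.
- have /IH : path_from B_step (pending (c :: st))%:Z s.
    by congr path_from : hs; rewrite /pending /U /=; lia.
  case=> /= IHp -> ->; split=> //.
  by congr path_from : IHp; rewrite /U; lia.
- case: st hx hs => [|[|c] st] //= hx hs.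
  + have /IH [IHp -> ->] : path_from B_step (pending st)%:Z s.
      by congr path_from : hs; rewrite /pending /D /=; lia.
    by split=> //; congr path_from : IHp; rewrite /D; lia.
  + have /IH [/= IHp -> ->] : path_from B_step (pending (c :: st))%:Z s.
      by congr path_from : hs; rewrite /pending /D /=; lia.
    by split=> //; rewrite addr0.
Qed.

Lemma untransduceK (h : nat) m : path_from motzkin_step h%:Z m ->
  let: (st, s) := untransduce m in
  [/\ size st = h, path_from B_step (pending st)%:Z s, size s = size m
    & transduce st s = m].
Proof.
elim: m h => [|x m IH] h /=; first by move=> /eqP [->].
case/and3P; rewrite /motzkin_step !inE => /or3P [] /eqP -> hx hm /=.
- have /IH : path_from motzkin_step h.+1%:Z m.
    by congr path_from : hm; rewrite /U; lia.
  (* An up step from [h] leaves [h.+1] counters after it, so there is one to close. *)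
  case: untransduce => [[|c st] s] [] //= [sz] Bs -> <-; split=> //.
  by rewrite /B_step /=; congr path_from : Bs; rewrite /pending /U /=; lia.
- have /IH : path_from motzkin_step h%:Z m by congr path_from : hm; rewrite /F; lia.
  by case: untransduce => [[|c st] s] [] /= sz Bs -> <-; split.
- case: h hx hm => // h hx hm.
  have /IH : path_from motzkin_step h%:Z m.
    by congr path_from : hm; rewrite /D; lia.
  case: untransduce => [st s] [] /= -> Bs -> <-; split=> //.
  by rewrite /B_step /=; congr path_from : Bs; rewrite /pending /D /=; lia.
Qed.

(** Down steps have size one, so the path cannot skip a level: cut it at its first passage from
    ordinate [k.+1] to [k]. [L] is then lowered by [k.+1]. *)
Lemma split_first_descent (h k : nat) s :
  path_from lukasiewicz_step (h + k.+1)%N%:Z s ->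
  exists L R, [/\ s = L ++ D :: R, path_from lukasiewicz_step h%:Z L
                & path_from lukasiewicz_step k%:Z R].
Proof.
elim: s h => [|x s IH] h /=; first by rewrite addnS.
case/and3P => x_ge hx hs; have [hx0|hx0] := ltP (h%:Z + x) 0.
  (* With [x >= -1], dropping below 0 from [h] leaves only this case, which is the cut. *)
  have [h0 xD] : h = 0%N /\ x = D by move: x_ge; rewrite /lukasiewicz_step /D; lia.
  exists [::], s; rewrite h0 xD in hs *; split=> //.
  by congr path_from : hs; rewrite /D; lia.
have [h' hE] : exists h' : nat, h%:Z + x = h'%:Z by exists `|(h%:Z + x)%R|%N; lia.
have [|L [R [-> hL hR]]] := IH h'; first by congr path_from : hs; lia.
by exists (x :: L), R; split=> //=; apply/and3P; rewrite hE.
Qed.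

Lemma split_descents (k : nat) s : path_from lukasiewicz_step k%:Z s ->
  exists Ls L, [/\ s = flatten [seq rcons L' D | L' <- Ls] ++ L, size Ls = k,
    forall L', L' \in Ls -> lukasiewicz L' & lukasiewicz L].
Proof.
elim: k s => [|k IH] s; first by move=> /lukasiewiczE Ls; exists [::], s.
move=> /(@split_first_descent 0) [L1 [R [-> /lukasiewiczE L1P]]].
case/IH => Ls [L [-> <- LsP LP]]; exists (L1 :: Ls), L; split=> //.
  by rewrite /= -catA cat_rcons.
by move=> L'; rewrite inE => /orP [/eqP ->|/LsP].
Qed.

(** The counter [size Ls] stands for one down step per factor: all but the last become the
    separating [F], the last becomes [D]. The hypothesis on the factors is what the induction in
    [transduce_cat] supplies. *)
Lemma transduce_join_flat L1 Ls st R :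
  (forall L st' R', L \in L1 :: Ls ->
     transduce st' (L ++ R') = psi L ++ transduce st' R') ->
  transduce (size Ls :: st) (flatten [seq rcons L D | L <- L1 :: Ls] ++ R) =
  join_flat [seq psi L | L <- L1 :: Ls] ++ D :: transduce st R.
Proof.
elim: Ls L1 => [|L2 Ls IH] L1 psiE.
  by rewrite /= !cats0 cat_rcons psiE ?mem_head.
rewrite map_cons [flatten _]/= -catA cat_rcons psiE ?mem_head //=.
rewrite -[rcons L2 D ++ _]/(flatten [seq rcons L D | L <- L2 :: Ls]).
rewrite IH /= -?catA /= -?catA // => L st' R' LP.
by apply: psiE; rewrite inE LP orbT.
Qed.

(** A Łukasiewicz factor pops exactly what it pushes, so the stack below it is left intact. The
    induction is on size because the factors of the decomposition are not tails of the path. *)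
Lemma transduce_cat L st R : lukasiewicz L ->
  transduce st (L ++ R) = psi L ++ transduce st R.
Proof.
have [n] := ubnP (size L); elim: n => // n IH in L st R *.
case: L => [//|x s] /= s_lt /lukasiewiczE /and3P [/stepP x_ge x_ge0].
case: x_ge s_lt x_ge0 => [->|c ->|-> //] s_lt _; rewrite add0r.
  by rewrite psi_F => /lukasiewiczE sP /=; rewrite IH.
case/split_descents => -[|L1 Ls] [L [sE sz LsP LP]] //.
(* [split_down] returns exactly these factors, so its size bounds justify the induction hypothesis
   for them. *)
have := size_split_down (size (L1 :: Ls)) s.
rewrite {1 3}sE split_down_cat // => -[Ls_le L_le].
have LsE L' st' R' : L' \in L1 :: Ls ->
    transduce st' (L' ++ R') = psi L' ++ transduce st' R'.
  by move=> L'P; apply: IH; [exact: leq_ltn_trans (Ls_le _ L'P) _|exact: LsP].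
rewrite {}sE (psi_U (k := c.+1) L isT sz LsP) cat_cons -catA.
have [<-] := sz.
rewrite /= (transduce_join_flat _ _ LsE) IH //.
  by rewrite /= -!catA.
exact: leq_ltn_trans L_le _.
Qed.

Lemma psi_transduce s : lukasiewicz s -> psi s = transduce [::] s.
Proof. by move=> sP; rewrite -[s in RHS]cats0 transduce_cat // cats0. Qed.

Theorem theorem7 (n : nat) : set_bij (B n) (M n) psi.
Proof.
have B_psi s : B n s -> M n (psi s) /\ untransduce (psi s) = ([::], s).
  move=> sB; rewrite psi_transduce; last by case: sB.
  by have /BE [/(@transduceK [::]) [sM sz sK] <-] := sB; split=> //; apply/ME.
split=> [s /B_psi []//|s t|m /ME [mM mn]].
- move=> /set_mem /B_psi [_ sK] /set_mem /B_psi [_ tK] st.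
  by move: sK; rewrite st tK => -[].
(* At height 0 the recovered stack is empty, so the recovered input is a preimage under [transduce
   [::]], hence under [psi]. *)
- have := @untransduceK 0 m mM; case: untransduce => st s [/size0nil ->] /= Bs sz <-.
  have sB : B n s by apply/BE; rewrite sz.
  by exists s => //; rewrite psi_transduce //; case: sB.
Qed.
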